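(* Let $G$ be a partial cube obtained by edge-pasting from finite partial cubes $G_1$ and $G_2$. Then $$\max\{\dim_Z(G_1),\dim_Z(G_2)\}\leq\dim_Z(G)\leq\dim_Z(G_1)+\dim_Z(G_2).$$
   Context: Graphs are simple, undirected and nonempty. For a set $X$, the hypercube $\mathcal H(X)$ is the graph whose vertices are the finite subsets of $X$, with $P,Q$ adjacent iff $|P\Delta Q|=1$. A graph is a partial cube if it can be isometrically embedded (i.e. by a map preserving shortest-path distances) into some $\mathcal H(X)$. The integer lattice $\mathcal Z^n$ is the graph with vertex set $\mathbb Z^n$ in which two vertices are adjacent iff their $\ell_1$-distance is $1$. The lattice dimension $\dim_Z(G)$ of a finite partial cube $G$ is the minimum $n$ such that $G$ is isometrically embeddable into $\mathcal Z^n$ (every finite partial cube is so embeddable for some $n$). Edge-pasting: given connected graphs $G_1=(V_1,E_1)$, $G_2=(V_2,E_2)$ and edges $a_1b_1\in E_1$, $a_2b_2\in E_2$, the graph obtained by edge-pasting is the graph obtained from the disjoint union of $G_1$ and $G_2$ by identifying $a_1$ with $a_2$, $b_1$ with $b_2$, and the edge $a_1b_1$ with the edge $a_2b_2$ (and making no other identifications). *)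

(* Defs.v *)
From HB Require Import structures.
From mathcomp Require Import all_boot all_order all_algebra.
From mathcomp Require Import finmap boolp classical_sets cardinality.

Set Implicit Arguments.
Unset Strict Implicit.
Unset Printing Implicit Defensive.

Import Order.TTheory GRing.Theory Num.Theory.

(* The vertex type is arbitrary, since hypercubes and lattices are infinite;
   finiteness is expressed by [finite_set [set: G]]. *)
Record sgraph := SGraph {
  vertex :> Type;
  adj : rel vertex;
  adj_sym : symmetric adj;
  adj_irr : irreflexive adj;
  vertex_inh : inhabited vertex }.

(* [None] when no natural number satisfies [P]. *)
Definition least (P : nat -> Prop) : option nat :=
  if pselect (exists n, `[< P n >]) is left exP then Some (ex_minn exP)
  else None.

Lemma least_SomeP (P : nat -> Prop) (n : nat) :
  least P = Some n <-> P n /\ (forall m, P m -> n <= m).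
Proof.
rewrite /least; case: pselect => [exP|nP]; last first.
  by split=> // -[Pn _]; case: nP; exists n; apply/asboolP.
case: ex_minnP => k /asboolP Pk mink; split=> [[<-]|[Pn minn]].
  by split=> // m Pm; apply: mink; apply/asboolP.
congr Some; apply/eqP; rewrite eqn_leq minn // andbT.
by apply: mink; apply/asboolP.
Qed.

Definition walk (G : sgraph) (x y : G) (n : nat) : Prop :=
  exists p : seq G, [/\ path (@adj G) x p, last x p = y & size p = n].

(* [None] is the infinite distance between distinct components. *)
Definition gdist (G : sgraph) (x y : G) : option nat := least (walk x y).

Definition isometric_embedding (G H : sgraph) (f : G -> H) : Prop :=
  forall x y : G, gdist (f x) (f y) = gdist x y.

Definition isometrically_embeddable (G H : sgraph) : Prop :=
  exists f : G -> H, isometric_embedding f.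

Section Hypercube.
Variable X : choiceType.
Local Open Scope fset_scope.

Definition hypercube_adj (P Q : {fset X}) : bool :=
  #|` (P `\` Q) `|` (Q `\` P) | == 1%N.

Lemma hypercube_adj_sym : symmetric hypercube_adj.
Proof. by move=> P Q; rewrite /hypercube_adj fsetUC. Qed.

Lemma hypercube_adj_irr : irreflexive hypercube_adj.
Proof. by move=> P; rewrite /hypercube_adj fsetDv fsetU0 cardfs0. Qed.

Definition hypercube : sgraph :=
  SGraph hypercube_adj_sym hypercube_adj_irr (inhabits fset0).
End Hypercube.

(* Every type carries a choiceType structure classically, so letting [X] range
   over choiceType loses no sets. *)
Definition partial_cube (G : sgraph) : Prop :=
  exists X : choiceType, isometrically_embeddable G (hypercube X).

Section Lattice.
Variable n : nat.
Local Open Scope ring_scope.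

Definition lattice_adj (x y : 'rV[int]_n) : bool :=
  \sum_(i < n) `|x ord0 i - y ord0 i| == 1.

Lemma lattice_adj_sym : symmetric lattice_adj.
Proof.
move=> x y; rewrite /lattice_adj; congr (_ == _).
by apply: eq_bigr => i _; rewrite distrC.
Qed.

Lemma lattice_adj_irr : irreflexive lattice_adj.
Proof.
by move=> x; rewrite /lattice_adj big1 // => i _; rewrite subrr normr0.
Qed.

Definition lattice : sgraph :=
  SGraph lattice_adj_sym lattice_adj_irr (inhabits 0).
End Lattice.

(* The default 0 is a junk value, used only for graphs embeddable in no
   lattice; finite partial cubes are always embeddable. *)
Definition dimZ (G : sgraph) : nat :=
  odflt 0 (least (fun n => isometrically_embeddable G (lattice n))).

Section EdgePasting.
Variables (G1 G2 : sgraph) (a1 b1 : G1) (a2 b2 : G2).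

Definition sum_adj (u v : G1 + G2) : bool :=
  match u, v with
  | inl x, inl y => adj x y
  | inr x, inr y => adj x y
  | _, _ => false
  end.

(* An equivalence relation as soon as a1 <> b1 and a2 <> b2. *)
Definition glued (u v : G1 + G2) : Prop :=
  match u, v with
  | inl x, inl y => x = y
  | inr x, inr y => x = y
  | inl x, inr y | inr y, inl x => (x = a1 /\ y = a2) \/ (x = b1 /\ y = b2)
  end.

(* [G] is, up to isomorphism, the quotient of the disjoint union of [G1] and
   [G2] by [glued], with quotient map [q]. *)
Definition edge_pasting (G : sgraph) : Prop :=
  exists q : G1 + G2 -> G,
    [/\ forall x : G, exists u, q u = x,
        forall u v, q u = q v <-> glued u v
      & forall x y : G,
          adj x y <-> exists u v, [/\ q u = x, q v = y & sum_adj u v]].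
End EdgePasting.

(* Main.v *)
(* Let f1, f2 be isometric embeddings of G1, G2 in Z^n1, Z^n2, and for y in G2
   let p y be whichever end of the common edge ab is nearer to y.  Then
     x in G1 |-> (f1 x, f2 a),   y in G2 |-> (f1 (p y), f2 y - (f2 (p y) - f2 a))
   is well defined on G.  It sends edges to edges, so it does not increase
   distances; and any two vertices of G are joined by a walk as long as the
   l1-distance of their images, passing through p y between x and y.  So the map
   is isometric, and the distances it computes show that G1 and G2 are isometric
   subgraphs of G. *)
Require Import Defs.
From mathcomp Require Import all_boot all_order all_algebra.
From mathcomp Require Import finmap boolp classical_sets cardinality.
From mathcomp Require Import zify.

Set Implicit Arguments.
Unset Strict Implicit.
Unset Printing Implicit Defensive.

Import Order.TTheory GRing.Theory Num.Theory.

(** * Walks, distances and isometric embeddings *)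

Lemma walk0 (G : sgraph) (x : G) : walk x x 0.
Proof. by exists [::]. Qed.

Lemma walk_adj (G : sgraph) (x y z : G) n :
  adj x y -> walk y z n -> walk x z n.+1.
Proof. by move=> xy [p [py lp <-]]; exists (y :: p); rewrite /= xy. Qed.

Lemma walk_cat (G : sgraph) (x y z : G) m n :
  walk x y m -> walk y z n -> walk x z (m + n).
Proof.
move=> [p [px lp <-]] [r [ry lr <-]]; exists (p ++ r).
by rewrite cat_path last_cat size_cat px lp ry lr.
Qed.

Lemma walk_sym (G : sgraph) (x y : G) n : walk x y n -> walk y x n.
Proof.
move=> [p [px <- <-]]; elim: p x px => [|z p IHp] x /=; first by move=> _; exact: walk0.
move=> /andP[xz pz]; rewrite -addn1.
by apply: walk_cat (IHp _ pz) _; apply: walk_adj (walk0 _); rewrite adj_sym.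
Qed.

Lemma walk_homo (G H : sgraph) (f : G -> H) x y n :
  {homo f : x y / adj x y} -> walk x y n -> walk (f x) (f y) n.
Proof.
by move=> fh [p [px <- <-]]; exists (map f p); rewrite last_map size_map (homo_path fh).
Qed.

Lemma gdist_walk (G : sgraph) (x y : G) n : gdist x y = Some n -> walk x y n.
Proof. by move=> /least_SomeP[]. Qed.

Lemma gdist_adj (G : sgraph) (x y : G) : adj x y -> gdist x y = Some 1.
Proof.
move=> xy; apply/least_SomeP; split; first exact: walk_adj (walk0 _).
move=> [|//] [p [_ + /size0nil p0]]; rewrite p0 /= => exy.
by move: xy; rewrite exy adj_irr.
Qed.

(** A function that vanishes on the diagonal and drops by at most one along an edge is a lower bound
    for walk lengths; the last hypothesis says that the bound is attained. *)
Lemma gdistE (G : sgraph) (d : G -> G -> nat) :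
    (forall x, d x x = 0) ->
    (forall x y z, adj x y -> d x z <= (d y z).+1) ->
    (forall x y, walk x y (d x y)) ->
  forall x y, gdist x y = Some (d x y).
Proof.
move=> dxx dadj dwalk x y; apply/least_SomeP; split=> // _ [p [px <- <-]].
elim: p x px => [|z p IHp] x /=; first by rewrite dxx.
by move=> /andP[xz /IHp]; rewrite -ltnS; apply: leq_trans (dadj _ _ _ xz).
Qed.

Lemma walk_descent (G : sgraph) (d : G -> G -> nat) :
    (forall x y, d x y = 0 -> x = y) ->
    (forall x y, 0 < d x y -> exists2 z, adj x z & d x y = (d z y).+1) ->
  forall x y, walk x y (d x y).
Proof.
move=> d0 ddesc x y; move En: (d x y) => n; elim: n x En => [|n IHn] x En.
  by rewrite (d0 _ _ En); exact: walk0.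
have [|z xz dz] := ddesc x y; first by rewrite En.
by apply: (walk_adj xz); apply: IHn; move: dz; rewrite En => -[].
Qed.

Lemma isometrically_embeddable_trans (G H K : sgraph) :
  isometrically_embeddable G H -> isometrically_embeddable H K ->
  isometrically_embeddable G K.
Proof. by move=> [f fi] [g gi]; exists (g \o f) => x y /=; rewrite gi fi. Qed.

(** * Graph distance in the integer lattice *)

Section LatticeDistance.
Local Open Scope ring_scope.

Definition l1dist n (x y : 'rV[int]_n) : nat :=
  (\sum_(i < n) `|(x ord0 i - y ord0 i)%R|)%N.

Lemma lattice_adjE n (x y : lattice n) : adj x y = (l1dist x y == 1)%N.
Proof.
rewrite /adj /= /lattice_adj /l1dist -eqz_nat (big_morph Posz PoszD (erefl _)).
by congr (_ == _); apply: eq_bigr => i _; rewrite abszE.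
Qed.

Lemma l1dist0 n (x : 'rV_n) : l1dist x x = 0%N.
Proof. by apply: big1 => i _; rewrite subrr. Qed.

Lemma l1dist_sym n (x y : 'rV_n) : l1dist x y = l1dist y x.
Proof. by apply: eq_bigr => i _; rewrite distnC. Qed.

Lemma l1dist_triangle n (x y z : 'rV_n) :
  (l1dist x z <= l1dist x y + l1dist y z)%N.
Proof. by rewrite /l1dist -big_split leq_sum // => i _ /=; lia. Qed.

Lemma l1dist_trans n (t x y : 'rV_n) : l1dist (x - t) (y - t) = l1dist x y.
Proof. by apply: eq_bigr => i _; rewrite !mxE opprB addrA subrK. Qed.

Lemma l1dist_row_mx m n (x x' : 'rV_m) (y y' : 'rV_n) :
  l1dist (row_mx x y) (row_mx x' y') = (l1dist x x' + l1dist y y')%N.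
Proof.
rewrite /l1dist big_split_ord /=; congr addn; apply: eq_bigr => i _.
  by rewrite !row_mxEl.
by rewrite !row_mxEr.
Qed.

Lemma l1dist_walk n (x y : lattice n) : walk x y (l1dist x y).
Proof.
apply: walk_descent => {x y} x y.
  move=> /eqP; rewrite sum_nat_eq0 => /forallP d0; apply/rowP => i.
  by have := d0 i; rewrite implyTb absz_eq0 subr_eq0 => /eqP.
rewrite lt0n sum_nat_eq0 negb_forall => /existsP[j]; rewrite implyTb => xj.
(* The neighbour [z] moves one unit towards [y] in a coordinate [j] where [x] and [y] differ. *)
pose z : 'rV_n := \row_i
  (if i == j then x ord0 j + Num.sg (y ord0 j - x ord0 j) else x ord0 i).
exists z; rewrite ?lattice_adjE /l1dist (bigD1 j) //=.
  rewrite big1 => [|i /negbTE ij]; rewrite mxE ?ij ?eqxx ?subrr //.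
  by case: sgrP; lia.
rewrite [in RHS](bigD1 j) //= -addSn mxE eqxx; congr addn.
  by case: sgrP; lia.
by apply: eq_bigr => i /negbTE ij; rewrite mxE ij.
Qed.

Lemma gdist_lattice n (x y : lattice n) : gdist x y = Some (l1dist x y).
Proof.
apply: (@gdistE (lattice n) (@l1dist n)); [exact: l1dist0| |exact: l1dist_walk].
move=> {}x {}y z; rewrite lattice_adjE => /eqP xy.
by have := l1dist_triangle x y z; rewrite xy.
Qed.

Lemma l1dist1 n (x y : 'rV_n) : l1dist x y = 1%N ->
  exists j, `|x ord0 j - y ord0 j|%N = 1%N /\
            forall i, i != j -> x ord0 i = y ord0 i.
Proof.
move=> xy; have /forallPn[j] : ~~ [forall i, `|x ord0 i - y ord0 i|%N == 0%N].
  apply/negP => /forallP d0; move: xy; rewrite /l1dist big1 // => i _.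
  exact/eqP.
move=> xj; exists j; move: xy; rewrite /l1dist (bigD1 j) //= => xy.
split=> [|i ij]; first lia.
move: xy; rewrite (bigD1 i) //=; lia.
Qed.

(** The points [a] and [b] differ in a single coordinate, by one, so [u] and [v] lie on opposite
    sides of the gap between them; translating by [a - b] brings [v] one unit closer to [u]. *)
Lemma l1dist_shift n (a b u v : 'rV_n) : l1dist a b = 1%N ->
    (l1dist u a <= l1dist u b)%N -> (l1dist v b < l1dist v a)%N ->
  l1dist u v = (l1dist u (v - (b - a))).+1.
Proof.
move=> /l1dist1 [j [abj abi]]; rewrite /l1dist ![(\sum_(i < n) _)%N](bigD1 j) //=.
have rest (w : 'rV[int]_n) : (\sum_(i < n | i != j) `|(w ord0 i - a ord0 i)%R| =
   \sum_(i < n | i != j) `|(w ord0 i - b ord0 i)%R|)%N.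
  by apply: eq_bigr => i /abi ->.
rewrite !rest leq_add2r ltn_add2r => ua vb; rewrite -[RHS]addSn; congr addn; last first.
  by apply: eq_bigr => i /abi ab; rewrite !mxE ab subrr subr0.
rewrite !mxE; move: ua vb abj.
by move: (a _ _) (b _ _) (u _ _) (v _ _) => A B U V; lia.
Qed.

End LatticeDistance.

(** * Graph distance in the hypercube *)

Section HypercubeDistance.
Variable X : choiceType.
Implicit Types P Q R U : {fset X}.
Local Open Scope fset_scope.

Definition symdiff P Q := (P `\` Q) `|` (Q `\` P).

Lemma in_symdiff P Q k : (k \in symdiff P Q) = (k \in P) (+) (k \in Q).
Proof. by rewrite !inE; case: (k \in P); case: (k \in Q). Qed.

Lemma gdist_hypercube (P Q : hypercube X) :
  gdist P Q = Some #|` symdiff P Q|.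
Proof.
apply: (@gdistE (hypercube X) (fun P Q => #|` symdiff P Q|)) => {P Q} [P|P Q R|].
- by rewrite /symdiff fsetDv fsetU0 cardfs0.
- rewrite /adj /= /hypercube_adj -/(symdiff P Q) => /eqP PQ.
  rewrite -add1n -PQ; apply: leq_trans (leq_card_fsetU _ _).
  apply/fsubset_leq_card/fsubsetP => k; rewrite in_fsetU !in_symdiff.
  by case: (k \in P); case: (k \in Q); case: (k \in R).
apply: walk_descent => P Q.
  move=> /eqP; rewrite cardfs_eq0 => /eqP/fsetP PQ; apply/fsetP => k.
  by have := PQ k; rewrite in_symdiff inE; case: (k \in P); case: (k \in Q).
rewrite cardfs_gt0 => /fset0Pn[k kPQ].
(* Toggling [k] in [P] removes exactly [k] from the symmetric difference with [Q]. *)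
exists (symdiff P [fset k]).
  rewrite /adj /= /hypercube_adj -/(symdiff _ _).
  suff -> : symdiff P (symdiff P [fset k]) = [fset k] by rewrite cardfs1.
  by apply/fsetP => i; rewrite !in_symdiff; case: (i \in P); case: (i \in _).
rewrite (cardfsD1 k) kPQ add1n; congr (#|` _|.+1); apply/fsetP => i.
rewrite in_fsetD1 !in_symdiff in_fset1; case: eqP => [->|_] /=.
  by move: kPQ; rewrite in_symdiff; case: (k \in P); case: (k \in Q).
by rewrite addbF.
Qed.

(** Summing over a fixed [U] gives the cardinal the shape of an l1 distance with coordinates indexed
    by [U]. *)
Lemma card_fset_sum P U : P `<=` U -> #|` P| = \sum_(k <- U) (k \in P).
Proof.
move=> /fsubsetP PU; rewrite -big_mkcond /= sum1_count -size_filter.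
apply/perm_size/uniq_perm; rewrite ?filter_uniq ?fset_uniq // => k.
by rewrite mem_filter; apply/idP/andP => [kP|[]//]; rewrite kP PU.
Qed.

End HypercubeDistance.

(** * Lattice dimension of finite partial cubes *)

Lemma finite_partial_cube_embeddable (G : sgraph) :
  finite_set [set: G]%classic -> partial_cube G ->
  exists n, isometrically_embeddable G (lattice n).
Proof.
move=> finG [X [f fi]]; have [A rA] := finite_fsetP.1 (finite_image f finG).
(* The union [U] of the finitely many sets [f x] supplies the coordinates. The map [F] takes
   characteristic vectors, whose l1 distance counts the symmetric difference. *)
pose U := (\bigcup_(P <- A) P)%fset.
have fU x : (f x `<=` U)%fset.
  apply: (bigfcup_sup (P := xpredT) id) => //.
  have : (f @` setT)%classic (f x) by exists x.
  by rewrite rA.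
pose F x : 'rV[int]_(size U) := (\row_i (tnth (in_tuple U) i \in f x)%:R)%R.
exists (size U), F => x y; rewrite -fi gdist_lattice gdist_hypercube.
have sub : (symdiff (f x) (f y) `<=` U)%fset.
  by rewrite fsubUset !(fsubset_trans (fsubsetDl _ _)).
congr Some; rewrite [RHS](card_fset_sum sub) big_tnth.
apply: eq_bigr => i _; rewrite !mxE in_symdiff.
by case: (_ \in f x); case: (_ \in f y).
Qed.

(** One embedding into a lattice rules out the default value 0 in [dimZ], which is then a true
    minimum. *)
Lemma dimZP (G : sgraph) n : isometrically_embeddable G (lattice n) ->
  isometrically_embeddable G (lattice (dimZ G)) /\ dimZ G <= n.
Proof.
move=> Gn; rewrite /dimZ; case E: (least _) => [d|] /=.
  by have [Gd dmin] := (least_SomeP _ _).1 E; split=> //; exact: dmin.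
move: E; rewrite /least; case: pselect => // nex _; case: nex.
by exists n; apply/asboolP.
Qed.

Lemma dimZ_le (G H : sgraph) n : isometrically_embeddable G H ->
  isometrically_embeddable H (lattice n) -> dimZ G <= dimZ H.
Proof.
move=> GH /dimZP[Hd _].
by have [] := dimZP (isometrically_embeddable_trans GH Hd).
Qed.

(** * The isometric map on the pasted graph *)

Section EdgePastingEmbedding.
Variables (G1 G2 G : sgraph) (a1 b1 : G1) (a2 b2 : G2).
Variables (n1 n2 : nat) (f1 : G1 -> lattice n1) (f2 : G2 -> lattice n2).
Hypotheses (f1i : isometric_embedding f1) (f2i : isometric_embedding f2).
Hypotheses (edge1 : adj a1 b1) (edge2 : adj a2 b2).
Local Open Scope ring_scope.

Let walk1 x y : walk x y (l1dist (f1 x) (f1 y)).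
Proof. by apply: gdist_walk; rewrite -f1i gdist_lattice. Qed.

Let walk2 x y : walk x y (l1dist (f2 x) (f2 y)).
Proof. by apply: gdist_walk; rewrite -f2i gdist_lattice. Qed.

Let l1dist_adj (H : sgraph) n (f : H -> lattice n) x y :
  isometric_embedding f -> adj x y -> l1dist (f x) (f y) = 1%N.
Proof. by move=> fi /gdist_adj; rewrite -fi gdist_lattice => -[]. Qed.

(** Ties do not occur, as [f2 a2] and [f2 b2] differ by one in a single coordinate; the negation
    thus means strictly nearer to [a2]. *)
Let nearb (y : G2) := (l1dist (f2 y) (f2 b2) < l1dist (f2 y) (f2 a2))%N.
(** Together with [proj2], the two names of one vertex of the pasted graph: the end of the common
    edge nearer to [y]. *)
Let proj1 y := if nearb y then b1 else a1.
Let proj2 y := if nearb y then b2 else a2.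

(* Translating the half of [G2] nearer to [b2] by [f2 a2 - f2 b2] contracts
   exactly the edges parallel to [a2 b2]; the distance this loses is
   recovered in the [G1] coordinates. *)
Definition pasted_map (u : G1 + G2) : lattice (n1 + n2) :=
  match u with
  | inl x => row_mx (f1 x : 'rV_n1) (f2 a2 : 'rV_n2)
  | inr y => row_mx (f1 (proj1 y) : 'rV_n1)
                    ((f2 y : 'rV_n2) - ((f2 (proj2 y) : 'rV_n2) - f2 a2))
  end.

Let nearb_a2 : nearb a2 = false.
Proof. by rewrite /nearb l1dist0 ltn0. Qed.

Let nearb_b2 : nearb b2.
Proof. by rewrite /nearb l1dist0 l1dist_sym (l1dist_adj f2i edge2). Qed.

(** Each of [a2] and [b2] is its own nearer end, so both get the second block [f2 a2], which is the
    constant block used on [G1]. *)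
Lemma pasted_map_glued u v : glued a1 b1 a2 b2 u v -> pasted_map u = pasted_map v.
Proof.
have ga : pasted_map (inl a1) = pasted_map (inr a2).
  by rewrite /= /proj1 /proj2 nearb_a2 subrr subr0.
have gb : pasted_map (inl b1) = pasted_map (inr b2).
  by rewrite /= /proj1 /proj2 nearb_b2 opprB addrCA subrr addr0.
by case: u v => [x|x] [y|y] /=; [move=> -> // | case | case | move=> -> //];
   move=> [-> ->]; rewrite -?ga -?gb.
Qed.

Lemma pasted_map_inl x y :
  l1dist (pasted_map (inl x)) (pasted_map (inl y)) = l1dist (f1 x) (f1 y).
Proof. by rewrite l1dist_row_mx l1dist0 addn0. Qed.

(** Two points nearer to the same end get the same translation and the same first block. Otherwise
    the second block loses one by [l1dist_shift], and the first block gains the distance one between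
    [f1 a1] and [f1 b1]. *)
Lemma pasted_map_inr x y :
  l1dist (pasted_map (inr x)) (pasted_map (inr y)) = l1dist (f2 x) (f2 y).
Proof.
have ab := l1dist_adj f2i edge2; have ab1 := l1dist_adj f1i edge1.
have key z t : nearb z = false -> nearb t ->
    l1dist (f2 z) (f2 t) =
    (l1dist (f2 z : 'rV_n2) ((f2 t : 'rV_n2) - ((f2 b2 : 'rV_n2) - f2 a2))).+1.
  by rewrite /nearb => /negbT; rewrite -leqNgt; exact: l1dist_shift.
rewrite l1dist_row_mx /proj1 /proj2.
case xb: (nearb x); case yb: (nearb y);
  rewrite ?l1dist0 ?l1dist_trans ?subrr ?subr0 //.
- by rewrite [RHS]l1dist_sym (key _ _ yb xb) l1dist_sym ab1 add1n l1dist_sym.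
- by rewrite (key _ _ xb yb) ab1.
Qed.

Lemma pasted_map_inlr x y :
  l1dist (pasted_map (inl x)) (pasted_map (inr y)) =
  (l1dist (f1 x) (f1 (proj1 y)) + l1dist (f2 (proj2 y)) (f2 y))%N.
Proof.
(* Subtracting [f2 (proj2 y) - f2 a2] carries [f2 (proj2 y)] to [f2 a2], the second block of
   [inl x]. *)
rewrite l1dist_row_mx -(l1dist_trans (f2 (proj2 y) - f2 a2 : 'rV_n2)%R (f2 (proj2 y))).
by rewrite opprB (addrCA (f2 (proj2 y))) subrr addr0.
Qed.

Variable q : G1 + G2 -> G.
Hypothesis q_surj : forall x : G, exists u, q u = x.
Hypothesis q_glued : forall u v, q u = q v <-> glued a1 b1 a2 b2 u v.
Hypothesis q_adj :
  forall x y : G, adj x y <-> exists u v, [/\ q u = x, q v = y & sum_adj u v].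

Lemma pasted_map_walk u v :
  walk (q u) (q v) (l1dist (pasted_map u) (pasted_map v)).
Proof.
have hl : {homo (q \o inl) : x y / adj x y}.
  by move=> x y xy; apply/q_adj; exists (inl x), (inl y).
have hr : {homo (q \o inr) : x y / adj x y}.
  by move=> x y xy; apply/q_adj; exists (inr x), (inr y).
have wlr x y : walk (q (inl x)) (q (inr y))
    (l1dist (pasted_map (inl x)) (pasted_map (inr y))).
  rewrite pasted_map_inlr; apply: walk_cat (walk_homo hl (walk1 _ _)) _.
  (* The walk in [G1] and the walk in [G2] can be joined because [proj1 y] and [proj2 y] are
     glued. *)
  suff -> : (q \o inl) (proj1 y) = (q \o inr) (proj2 y).
    exact: walk_homo hr (walk2 _ _).
  by apply/q_glued; rewrite /= /proj1 /proj2; case: ifP => _; [right|left].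
case: u v => [x|x] [y|y].
- by rewrite pasted_map_inl; exact: walk_homo hl (walk1 _ _).
- exact: wlr.
- by rewrite l1dist_sym; apply: walk_sym; exact: wlr.
- by rewrite pasted_map_inr; exact: walk_homo hr (walk2 _ _).
Qed.

Lemma gdist_pasted u v :
  gdist (q u) (q v) = Some (l1dist (pasted_map u) (pasted_map v)).
Proof.
(* The map is read on [G] through a section [s] of [q]; by invariance under gluing, the choice of
   representatives does not matter. *)
have [s sK] := choice q_surj.
have Fq w : pasted_map (s (q w)) = pasted_map w.
  by apply: pasted_map_glued; apply/q_glued.
rewrite (gdistE (d := fun x y => l1dist (pasted_map (s x)) (pasted_map (s y)))).
- by rewrite !Fq.
- by move=> x; exact: l1dist0.
(* An edge of [G] lifts to an edge inside [G1] or [G2], whose ends have images at distance one; the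
   triangle inequality does the rest. *)
- move=> _ _ z /q_adj[u' [v' [<- <- uv]]]; rewrite !Fq.
  apply: leq_trans (l1dist_triangle _ (pasted_map v') _) _.
  rewrite -add1n leq_add2r; case: u' v' uv => [x|x] [y|y] //= xy.
    by rewrite (pasted_map_inl x y) (l1dist_adj f1i xy).
  by rewrite (pasted_map_inr x y) (l1dist_adj f2i xy).
- by move=> x y; rewrite -{1}(sK x) -{1}(sK y); exact: pasted_map_walk.
Qed.

Lemma edge_pasting_embeddings :
  [/\ isometrically_embeddable G1 G, isometrically_embeddable G2 G
    & isometrically_embeddable G (lattice (n1 + n2))].
Proof.
split.
- exists (q \o inl) => x y.
  by rewrite gdist_pasted pasted_map_inl -f1i gdist_lattice.
- exists (q \o inr) => x y.
  by rewrite gdist_pasted pasted_map_inr -f2i gdist_lattice.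
- have [s sK] := choice q_surj; exists (pasted_map \o s) => x y.
  by rewrite gdist_lattice -{2}(sK x) -{2}(sK y) gdist_pasted.
Qed.

End EdgePastingEmbedding.

Theorem theorem7p6 (G1 G2 G : sgraph) (a1 b1 : G1) (a2 b2 : G2)
  (finG1 : finite_set [set: G1]%classic) (finG2 : finite_set [set: G2]%classic)
  (pcG1 : partial_cube G1) (pcG2 : partial_cube G2) (pcG : partial_cube G)
  (edge1 : adj a1 b1) (edge2 : adj a2 b2)
  (pasteG : edge_pasting a1 b1 a2 b2 G) :
  (maxn (dimZ G1) (dimZ G2) <= dimZ G <= dimZ G1 + dimZ G2)%N.
Proof.
(* Here [dimZP] trades [n1] for the optimal [dimZ G1], and likewise for [G2], so that the pasted map
   lands in dimension [dimZ G1 + dimZ G2]. *)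
have [n1 /dimZP[[f1 f1i] _]] := finite_partial_cube_embeddable finG1 pcG1.
have [n2 /dimZP[[f2 f2i] _]] := finite_partial_cube_embeddable finG2 pcG2.
have [q [q_surj q_glued q_adj]] := pasteG.
have [G1G G2G GZ] := edge_pasting_embeddings f1i f2i edge1 edge2 q_surj q_glued q_adj.
rewrite geq_max (dimZ_le G1G GZ) (dimZ_le G2G GZ) /=.
by have [] := dimZP GZ.
Qed.
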